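(* Let $k,s\ge 2$ be integers, let $n$ be a positive integer and $p\in[0,1]$ such that \[\max\left\{n^2p^s,\; n(1-p^4)^{(k^2-3k-2)/4},\; \exp\left(-\tbinom{n}{2}p/4\right)\right\}\le 1/2.\] Then there exists an $n$-vertex graph $G$ with average degree $d(G)\ge\frac{n-1}{2}p$ such that $G$ is $K_{s,s}$-free and every induced subgraph $G'$ of $G$ which is $C_4$-free has $d(G')<k$.
   Context: All graphs are finite, simple and loopless; $d(G)=2|E(G)|/|V(G)|$. $H$-free means no (not necessarily induced) subgraph isomorphic to $H$. *)

(* Defs.v *)
From mathcomp Require Import all_boot all_order all_algebra.

Set Implicit Arguments.
Unset Strict Implicit.
Unset Printing Implicit Defensive.

Import GRing.Theory Num.Theory.
Local Open Scope ring_scope.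

Record sgraph (V : finType) := SGraph {
  adj :> rel V;
  adj_sym : symmetric adj;
  adj_irrefl : irreflexive adj }.

Definition edges (V : finType) (G : sgraph V) : {set {set V}} :=
  [set e : {set V} | [exists x, exists y, G x y && (e == [set x; y])]].

(* For the graph with no vertices this is 0, since x / 0 = 0. *)
Definition avg_degree (R : numFieldType) (V : finType) (G : sgraph V) : R :=
  (2 * #|edges G|)%:R / #|V|%:R.

Section Induced.
Variables (V : finType) (G : sgraph V) (S : {set V}).

Definition induced_rel : rel {x : V | x \in S} :=
  fun u v => G (val u) (val v).

Lemma induced_sym : symmetric induced_rel.
Proof. by move=> u v; exact: adj_sym. Qed.

Lemma induced_irrefl : irreflexive induced_rel.
Proof. by move=> u; exact: adj_irrefl. Qed.

Definition induced_subgraph : sgraph {x : V | x \in S} :=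
  SGraph induced_sym induced_irrefl.

End Induced.

(* Non-edges of H may be mapped to edges of G. *)
Definition has_subgraph (V W : finType) (G : sgraph V) (H : sgraph W) : Prop :=
  exists2 f : W -> V, injective f & forall x y, H x y -> G (f x) (f y).

Definition graph_free (V W : finType) (H : sgraph W) (G : sgraph V) : Prop :=
  ~ has_subgraph G H.

Section CompleteBipartite.
Variables s t : nat.

Definition complete_bipartite_rel : rel ('I_s + 'I_t) :=
  fun u v => match u, v with
             | inl _, inr _ | inr _, inl _ => true
             | _, _ => false
             end.

Lemma complete_bipartite_sym : symmetric complete_bipartite_rel.
Proof. by case=> u; case=> v. Qed.

Lemma complete_bipartite_irrefl : irreflexive complete_bipartite_rel.
Proof. by case. Qed.

Definition complete_bipartite : sgraph ('I_s + 'I_t)%type :=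
  SGraph complete_bipartite_sym complete_bipartite_irrefl.

End CompleteBipartite.

(* ordS is the successor modulo m, so this is the cycle C_m for 3 <= m; the
   conjunct i != j only matters for the degenerate case m = 1. *)
Section Cycle.
Variable m : nat.

Definition cycle_rel : rel 'I_m :=
  fun i j => (i != j) && ((j == ordS i) || (i == ordS j)).

Lemma cycle_sym : symmetric cycle_rel.
Proof. by move=> i j; rewrite /cycle_rel eq_sym orbC. Qed.

Lemma cycle_irrefl : irreflexive cycle_rel.
Proof. by move=> i; rewrite /cycle_rel eqxx. Qed.

Definition cycle_graph : sgraph 'I_m := SGraph cycle_sym cycle_irrefl.

End Cycle.

(* Main.v *)
Require Import Defs.
From mathcomp Require Import all_boot all_order all_algebra.
From mathcomp Require Import all_classical all_reals all_analysis.
From mathcomp Require Import ring lra zify.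

Import Order.TTheory GRing.Theory Num.Theory.
Local Open Scope ring_scope.

(* Take G = G(n, p).  By an exponential moment bound, G has fewer than half the
   expected number of edges with probability at most exp(-mu/8) <= 2^(-1/2), where
   mu is that expected number; by a union bound over embeddings it contains K_{s,s}
   with probability at most (n^2 p^s)^s <= 1/4.  If an induced C_4-free subgraph has
   average degree at least k, counting paths of length two shows that it has more
   than k^2 - k =: 2h vertices, hence some 2h vertices induce a C_4-free graph.
   Enumerate them as v_0, v_1, ... and pair v_{2i} with v_{2i+1}: each pair has at
   most one common neighbour among the later v_j.  Guessing that exceptional
   neighbour for every pair leaves at least (h-1)^2 paths of length two, pairwise
   edge-disjoint and all absent from G, which has probability at most
   (1 - p^2)^((h-1)^2).  There are C(n, 2h) (2h)^h <= n^(2h) choices of vertices and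
   guesses, and (h-1)^2 >= 2h (k^2-3k-2)/4, so this event has probability at most
   2^(-2h) <= 1/64.  The three bounds sum to less than 1. *)

(** * Random subsets with independent elements *)

Definition bernoulli_weight {R : realType} {E : finType} (p : R) (J : {set E}) : R :=
  \prod_e (if e \in J then p else 1 - p).

Lemma bernoulli_weight_ge0 {R : realType} {E : finType} (p : R) (J : {set E}) :
  0 <= p -> p <= 1 -> 0 <= bernoulli_weight p J.
Proof. by move=> p0 p1; apply: prodr_ge0 => e _; case: ifP => _; lra. Qed.

(** Independence: expanding the product of sums picks one branch at each [e], and [J] is the set
    where the first is picked. *)
Lemma expect_prod {R : realType} {E : finType} (p : R) (F H : E -> R) :
  \sum_(J : {set E}) bernoulli_weight p J * \prod_e (if e \in J then F e else H e)
  = \prod_e (p * F e + (1 - p) * H e).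
Proof.
rewrite bigA_distr; apply: eq_bigr => J _.
by rewrite -big_split; apply: eq_bigr => e _; case: ifP.
Qed.

Lemma sum_bernoulli_weight {R : realType} {E : finType} (p : R) :
  \sum_(J : {set E}) bernoulli_weight p J = 1.
Proof.
transitivity (\sum_(J : {set E}) bernoulli_weight p J *
    \prod_e (if e \in J then 1 else 1)).
  by apply: eq_bigr => J _; rewrite big1 ?mulr1// => e _; case: ifP.
by rewrite expect_prod big1 // => e _; ring.
Qed.

(** The indicator of [D \subset J] is a product over [e] whose factor is 0 exactly when [e] is in
    [D] but not in [J], so [expect_prod] applies. *)
Lemma prob_subset {R : realType} {E : finType} (p : R) (D : {set E}) :
  \sum_(J : {set E} | D \subset J) bernoulli_weight p J = p ^+ #|D|.
Proof.
transitivity (\sum_(J : {set E}) bernoulli_weight p J *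
    \prod_e (if e \in J then 1 else (e \notin D)%:R)).
  rewrite big_mkcond; apply: eq_bigr => J _.
  case: ifP => DJ.
    rewrite big1 ?mulr1// => e _; case: ifPn => // eJ.
    by rewrite (contra (fintype.subsetP DJ e)).
  have /fintype.subsetPn[e eD eJ] := negbT DJ.
  by rewrite (bigD1 e) //= (negbTE eJ) eD mul0r mulr0.
rewrite expect_prod (bigID [in D]) /= [X in _ * X]big1 ?mulr1; last first.
  by move=> e ->; rewrite !mulr1 addrC subrK.
by rewrite (eq_bigr (fun=> p)) ?prodr_const// => e ->; rewrite /= !(mulr1, mulr0) addr0.
Qed.

(** Inclusion-exclusion over the sets [U] of indices whose pairs all lie in [J]. By injectivity
    these pairs contain 2|U| elements, so the term has expectation (-p^2)^|U|, and the sum refolds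
    into a power. *)
Lemma prob_no_pair {R : realType} {E I : finType} (p : R) (a b : I -> E) :
    injective (fun t : I * bool => if t.2 then a t.1 else b t.1) ->
  \sum_(J : {set E} | [forall t, ~~ ((a t \in J) && (b t \in J))])
    bernoulli_weight p J = (1 - p ^+ 2) ^+ #|I|.
Proof.
set c := (X in injective X) => cI.
pose y (J : {set E}) t : R := ((a t \in J) && (b t \in J))%:R.
transitivity (\sum_(J : {set E}) bernoulli_weight p J * \prod_t (- y J t + 1)).
  rewrite big_mkcond; apply: eq_bigr => J _.
  case: ifPn => [/forallP aJ|/forallPn[t]].
    by rewrite big1 ?mulr1// => t _; rewrite /y (negbTE (aJ t)) oppr0 add0r.
  by rewrite negbK => yt; rewrite (bigD1 t) //= /y yt addNr mul0r mulr0.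
under eq_bigr => J _ do rewrite bigA_distr mulr_sumr.
rewrite exchange_big /= [RHS](_ : _ = \prod_(t : I) (- p ^+ 2 + 1)); last first.
  by rewrite prodr_const addrC.
rewrite bigA_distr; apply: eq_bigr => U _.
rewrite -big_mkcond prodr_const /= exprNn -exprM.
have cardU : #|c @: finset.setX U [set: bool]| = (2 * #|U|)%N.
  by rewrite card_imset // cardsX cardsT card_bool mulnC.
rewrite -cardU -(prob_subset p) mulr_sumr [RHS]big_mkcond.
apply: eq_bigr => J _; rewrite -big_mkcond.
rewrite prodrN (_ : \prod_(i in U) y J i = (c @: finset.setX U [set: bool] \subset J)%:R).
  by case: ifP => _; rewrite ?mulr1 ?mulr0 // mulrC.
case: (boolP (_ \subset _)) => [/fintype.subsetP sJ|/fintype.subsetPn[e /imsetP[[t d]]]].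
  rewrite big1 // => t tU; rewrite /y !sJ //; apply/imsetP.
    by exists (t, false); rewrite // !inE tU.
  by exists (t, true); rewrite // !inE tU.
rewrite !inE /= andbT => tU ->; rewrite /c /= => tJ.
rewrite (bigD1 t) //= /y (_ : _ && _ = false) ?mul0r //.
by case: d tJ => /negbTE ->; rewrite ?andbF.
Qed.

Lemma union_bound {R : realType} {W I : finType} (w : W -> R) (P : pred I)
    (Q : I -> pred W) (c : R) :
    (forall J, 0 <= w J) ->
    (forall i, P i -> \sum_(J | Q i J) w J <= c) ->
  \sum_(J | [exists i, P i && Q i J]) w J <= #|P|%:R * c.
Proof.
move=> w0 Qc.
apply: (@le_trans _ _ (\sum_(i | P i) \sum_(J | Q i J) w J)); last first.
  by rewrite -sum1_card natr_sum mulr_suml; apply: ler_sum => i /Qc; rewrite mul1r.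
rewrite (exchange_big_dep predT) //= big_mkcond; apply: ler_sum => J _.
case: ifP => [/existsP[i iPQ]|_]; last by apply: sumr_ge0 => i _.
by rewrite (bigD1 i) //= lerDl; apply: sumr_ge0.
Qed.

(** * Counting paths of length two in the absence of 4-cycles *)

Lemma handshake {V : finType} (G : sgraph V) :
  (2 * #|edges G| <= \sum_v #|[set u | G v u]|)%N.
Proof.
rewrite mulnC -sum_nat_const.
apply: (@leq_trans (\sum_(e in edges G) \sum_(v in e) 1)%N).
  apply: leq_sum => e; rewrite inE => /existsP[x /existsP[y /andP[xy /eqP ->]]].
  rewrite sum1_card cards2; case: eqP xy => // ->; by rewrite adj_irrefl.
rewrite (exchange_big_dep predT) //=; apply: leq_sum => v _.
rewrite sum1_card; apply: leq_trans (leq_imset_card (fun u => [set v; u]) _).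
apply: subset_leq_card; apply/fintype.subsetP => e; rewrite unfold_in inE.
move=> /andP[/existsP[x /existsP[y /andP[xy /eqP ->]]]].
rewrite !inE => /orP[]/eqP ->; apply/imsetP.
  by exists y; rewrite ?inE.
by exists x; rewrite ?inE 1?adj_sym // finset.setUC.
Qed.

(** The form in which C_4-freeness is used: a violation is a 4-cycle with opposite vertices x, y and
    z, w. *)
Definition unique_common_neighbour {V : finType} (G : sgraph V) (S : {set V}) :=
  forall x y z w, x \in S -> y \in S -> z \in S -> w \in S -> x != y ->
    G x z -> G y z -> G x w -> G y w -> z = w.

Lemma c4_free_unique_common_neighbour {V : finType} (G : sgraph V) (S : {set V}) :
  graph_free (cycle_graph 4) (induced_subgraph G S) -> unique_common_neighbour G S.
Proof.
move=> free x y z w xS yS zS wS xy xz yz xw yw; apply/eqP.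
apply: contra_notT free => zw.
have adj_neq u v : G u v -> (u == v) = false.
  by move=> uv; apply: contraTF uv => /eqP ->; rewrite adj_irrefl.
pose f (i : 'I_4) : {x : V | x \in S} :=
  match val i with
  | 0 => exist _ x xS | 1 => exist _ z zS | 2 => exist _ y yS | _ => exist _ w wS
  end.
have zx : G z x by rewrite adj_sym.
have zy : G z y by rewrite adj_sym.
have wx : G w x by rewrite adj_sym.
have wy : G w y by rewrite adj_sym.
exists f.
  move=> [i i4] [j j4] /(congr1 val) /eqP E; apply/val_inj => /=; move: E.
  move: i j i4 j4 => [|[|[|[|?]]]] [|[|[|[|?]]]] //= _ _;
    by rewrite ?(negbTE xy) ?(negbTE zw) ?[_ == x]eq_sym ?[w == _]eq_sym
       ?(negbTE xy) ?(negbTE zw) ?adj_neq.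
move=> [i i4] [j j4]; rewrite /= /cycle_rel /induced_rel.
move: i j i4 j4 => [|[|[|[|?]]]] [|[|[|[|?]]]] //=.
Qed.

(** Ordered paths of length two number sum d^2 - sum d. With m = |V| there are at most m^2 - m of
    them, since the ends determine the centre. As sum d >= km, this yields (k^2 - k) m <= m^2 -
    m. *)
Lemma unique_common_neighbour_card {V : finType} (G : sgraph V) (k : nat) :
    unique_common_neighbour G [set: V] -> (0 < #|V|)%N ->
    (k * #|V| <= 2 * #|edges G|)%N ->
  (k ^ 2 - k < #|V|)%N.
Proof.
move=> ucn V0 kV.
pose d v := #|[set u | G v u]|.
pose T := [set t : V * V * V | [&& G t.1.1 t.1.2, G t.1.1 t.2 & t.1.2 != t.2]].
pose P := [set t : V * V | t.1 != t.2].
have TP : (#|T| <= #|P|)%N.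
  have gI : {in T &, injective (fun t : V * V * V => (t.1.2, t.2))}.
    move=> [[v x] y] [[v' x'] y']; rewrite !inE /= => /and3P[vx vy xy].
    move=> /and3P[vx' vy' xy'] [? ?]; subst x' y'.
    suff -> : v = v' by [].
    by apply: (ucn x y); rewrite ?inE // adj_sym.
  rewrite -(card_in_imset gI); apply: subset_leq_card.
  by apply/fintype.subsetP => t /imsetP[[[v x] y]]; rewrite !inE /= => /and3P[_ _ xy] ->.
have cardP : (#|P| + #|V| = #|V| ^ 2)%N.
  have diag : #|[set t : V * V | t.1 == t.2]| = #|V|.
    rewrite -cardsT -(@card_imset _ _ (fun x : V => (x, x))); last by move=> x y [].
    apply: eq_card => -[x y]; rewrite !inE /=.
    by apply/eqP/imsetP => [->|[z _ [-> ->]]//]; exists y.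
  rewrite -mulnn -card_prod -{1}diag -(cardC [pred t : V * V | t.1 == t.2]) addnC.
  by congr (_ + _)%N; apply: eq_card => t; rewrite !inE.
have cardT : (#|T| + \sum_v d v = \sum_v d v ^ 2)%N.
  pose T1 := [set t : V * V * V | G t.1.1 t.1.2 && G t.1.1 t.2].
  have -> : (\sum_v d v ^ 2 = #|T1|)%N.
    rewrite -sum1_card (eq_bigl (fun t : V * V * V => predT t.1.1 && (t \in T1))) //.
    rewrite (partition_big (fun t : V * V * V => t.1.1) predT) //=.
    apply: eq_bigr => v _; rewrite sum1_card -mulnn -cardsX.
    rewrite -(@card_imset _ _ (fun t : V * V => (v, t.1, t.2)));
      last by move=> [? ?] [? ?] [-> ->].
    apply: eq_card => -[[v' x] y]; rewrite [RHS]unfold_in !inE /=.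
    apply/imsetP/andP => [[[x' y']]|[/andP[vx vy] /eqP vv]].
      by rewrite !inE /= => /andP[vx vy] [-> -> ->]; rewrite vx vy.
    by exists (x, y); rewrite ?inE /= -vv ?vx.
  have -> : (\sum_v d v = #|[set t in T1 | t.1.2 == t.2]|)%N.
    rewrite -sum1_card.
    rewrite (partition_big (fun t : V * V * V => t.1.1) predT) //=.
    apply: eq_bigr => v _; rewrite sum1_card /d.
    rewrite -(@card_imset _ _ (fun x : V => (v, x, x))); last by move=> ? ? [].
    apply: eq_card => -[[v' x] y]; rewrite [RHS]unfold_in !inE /=.
    apply/imsetP/andP => [[x']|[/andP[/andP[vx vy] /eqP xy] /eqP vv]].
      by rewrite !inE => vx [-> -> ->]; rewrite vx !eqxx.
    by exists x; rewrite ?inE -vv ?xy // -xy.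
  rewrite addnC -(cardsID [set t : V * V * V | t.1.2 == t.2] T1).
  congr (_ + _)%N; apply: eq_card => t; rewrite !inE //.
  by rewrite andbA andbC.
have := leq_trans kV (handshake G); rewrite -/(\sum_v d v)%N => kd.
(* Summing d^2 + k^2 >= 2kd over the vertices takes the place of Cauchy-Schwarz and avoids
   division. *)
have sq : (2 * k * (\sum_v d v) <= \sum_v d v ^ 2 + k ^ 2 * #|V|)%N.
  rewrite big_distrr /= [(k ^ 2 * _)%N]mulnC -sum_nat_const -big_split /=.
  by apply: leq_sum => v _; rewrite -mulnA [(k * _)%N]mulnC (nat_Cauchy _ _).
move: TP cardP cardT sq kd V0; move: (\sum_v d v)%N (\sum_v _ ^ 2)%N #|T| #|P| #|V|.
move=> a b t q m *; nia.
Qed.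

(** * Lower tail of the number of edges *)

(* Exponential moment at 1/2; the numerical input is exp(-1/2) <= 5/8. *)
Lemma prob_lower_tail {R : realType} {E : finType} (p : R) (D : {set E}) :
    0 <= p -> p <= 1 ->
  \sum_(J : {set E} | #|J :&: D|%:R < #|D|%:R * p / 2) bernoulli_weight p J
  <= expR (- (#|D|%:R * p / 8)).
Proof.
move=> p0 p1; pose c : R := expR (- (1 / 2)).
have c58 : c <= 5 / 8.
  (* Four factors exp(1/8) >= 9/8 suffice, as (9/8)^4 = 6561/4096 exceeds 8/5. *)
  have e8 : 9 / 8 <= expR (1 / 8) :> R by have := expR_ge1Dx (1 / 8 : R); lra.
  have e2 : 8 / 5 <= expR (1 / 2) :> R.
    rewrite (_ : 1 / 2 = 4%:R * (1 / 8)); last by field.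
    rewrite expRM_natl; apply: le_trans (_ : (9 / 8) ^+ 4 <= _); first by lra.
    by rewrite lerXn2r // nnegrE ?expR_ge0 //; lra.
  rewrite /c expRN -[5 / 8]invrK lef_pV2 ?posrE ?expR_gt0 ?invr_gt0; lra.
have c0 : 0 < c by exact: expR_gt0.
(* Markov's inequality: with mu = |D| p, the indicator of the event is at most exp(mu/4 - |J :&:
   D|/2), whose second part is the product over [e]. *)
apply: (@le_trans _ _ (\sum_(J : {set E}) bernoulli_weight p J *
    (expR (#|D|%:R * p / 4) *
     \prod_e (if e \in J then (if e \in D then c else 1) else 1)))).
  rewrite big_mkcond; apply: ler_sum => J _.
  have w0 := bernoulli_weight_ge0 p J p0 p1.
  have -> : \prod_e (if e \in J then (if e \in D then c else 1) else 1) =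
      expR (- (#|J :&: D|%:R / 2)).
    rewrite -big_mkcond -big_mkcondr.
    rewrite (eq_bigl [in J :&: D]) ?prodr_const; last by move=> e; rewrite !inE.
    by rewrite /c -expRM_natr; congr expR; field.
  rewrite -expRD; case: ifPn => [few|_]; last first.
    by rewrite mulr_ge0 // expR_ge0.
  by rewrite ler_peMr //; apply: le_trans (expR_ge1Dx _); lra.
under eq_bigr => J _ do rewrite mulrCA.
rewrite -mulr_sumr expect_prod (bigID [in D]) /= [X in _ * (_ * X)]big1 ?mulr1; last first.
  by move=> e /negbTE ->; rewrite !mulr1 addrC subrK.
rewrite (eq_bigr (fun=> p * c + (1 - p))) ; last by move=> e ->.
rewrite prodr_const.
(* Here pc + 1 - p <= 1 - 3p/8 <= exp(-3p/8), and 1/4 - 3/8 = -1/8 gives the final exponent. *)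
apply: (@le_trans _ _ (expR (#|D|%:R * p / 4) * expR (- (3 / 8 * p)) ^+ #|D|)).
  rewrite ler_pM2l ?expR_gt0 //; apply: lerXn2r; rewrite ?nnegrE ?expR_ge0 //.
    by rewrite addr_ge0 ?mulr_ge0 ?(ltW c0) //; lra.
  by apply: le_trans (expR_ge1Dx _); nra.
by rewrite -expRM_natr -expRD ler_expR; lra.
Qed.

(** * Graphs from random edge sets, and their bicliques *)

Definition set_rel {V : finType} (J : {set {set V}}) : rel V :=
  fun x y => (x != y) && ([set x; y] \in J).

Lemma set_rel_sym {V : finType} (J : {set {set V}}) : symmetric (set_rel J).
Proof. by move=> x y; rewrite /set_rel eq_sym finset.setUC. Qed.

Lemma set_rel_irrefl {V : finType} (J : {set {set V}}) : irreflexive (set_rel J).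
Proof. by move=> x; rewrite /set_rel eqxx. Qed.

(* Members of J that are not two-element sets play no role. *)
Definition set_graph {V : finType} (J : {set {set V}}) : sgraph V :=
  SGraph (set_rel_sym J) (set_rel_irrefl J).

Lemma card_edges_set_graph {V : finType} (J : {set {set V}}) :
  #|J :&: [set e : {set V} | #|e| == 2]| = #|edges (set_graph J)|.
Proof.
apply: eq_card => e; rewrite !inE.
apply/andP/existsP => [[eJ /cards2P[x [y [xy exy]]]]|[x /existsP[y]]].
  by exists x; apply/existsP; exists y; rewrite /= /set_rel xy -exy eJ eqxx.
by rewrite /= /set_rel => /andP[/andP[xy xyJ] /eqP ->]; rewrite cards2 xy.
Qed.

Definition biclique_edges {V : finType} {s t : nat} (f : 'I_s + 'I_t -> V) :
    {set {set V}} :=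
  [set [set f (inl ij.1); f (inr ij.2)] | ij : 'I_s * 'I_t].

Lemma card_biclique_edges {V : finType} {s t : nat} (f : 'I_s + 'I_t -> V) :
  injective f -> #|biclique_edges f| = (s * t)%N.
Proof.
move=> fI; rewrite card_imset ?card_prod ?card_ord // => -[i j] [i' j'] /= E.
have : f (inl i) \in [set f (inl i'); f (inr j')] by rewrite -E !inE eqxx.
have : f (inr j) \in [set f (inl i'); f (inr j')] by rewrite -E !inE eqxx orbT.
by rewrite !inE => /orP[]/eqP/fI // [->] /orP[]/eqP/fI // [->].
Qed.

Lemma prob_biclique {R : realType} {V : finType} (p : R) (s t : nat) :
    0 <= p -> p <= 1 ->
  \sum_(J : {set {set V}} | [exists f : {ffun 'I_s + 'I_t -> V},
      injectiveb f && (biclique_edges f \subset J)]) bernoulli_weight p J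
  <= #|V|%:R ^+ (s + t) * p ^+ (s * t).
Proof.
move=> p0 p1.
apply: le_trans (@union_bound R {set {set V}} {ffun 'I_s + 'I_t -> V} (bernoulli_weight p)
  (fun f => injectiveb f)
  (fun f J => biclique_edges f \subset J) (p ^+ (s * t)) _ _) _.
- by move=> J; exact: bernoulli_weight_ge0.
- by move=> f /injectiveP fI; rewrite prob_subset card_biclique_edges.
rewrite -natrX ler_wpM2r ?exprn_ge0 // ler_nat.
apply: leq_trans (max_card _) _.
by rewrite card_ffun card_sum !card_ord.
Qed.

Lemma has_biclique_edges {V : finType} (J : {set {set V}}) (s t : nat) :
    has_subgraph (set_graph J) (complete_bipartite s t) ->
  [exists f : {ffun 'I_s + 'I_t -> V}, injectiveb f && (biclique_edges f \subset J)].
Proof.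
move=> [f fI fE]; apply/existsP; exists [ffun x => f x]; apply/andP; split.
  by apply/injectiveP => x y; rewrite !ffunE => /fI.
apply/fintype.subsetP => e /imsetP[[i j] _ ->] /=; rewrite !ffunE.
by have /andP[] := fE (inl i) (inr j) isT.
Qed.

(** * Vertex pairs with few later common neighbours *)

(** Equal unordered pairs could also match crosswise; the order of the indices excludes this. *)
Lemma set2_nat_inj {V : finType} (m : nat) (v : nat -> V) (a b c d : nat) :
    (forall i j, (i < m)%N -> (j < m)%N -> v i = v j -> i = j) ->
    (a < b < m)%N -> (c < d < m)%N ->
  [set v a; v b] = [set v c; v d] -> a = c /\ b = d.
Proof.
move=> vI /andP[ab bm] /andP[cd dm] E.
have am := ltn_trans ab bm; have cm := ltn_trans cd dm.
have : v a \in [set v c; v d] by rewrite -E !inE eqxx.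
have : v b \in [set v c; v d] by rewrite -E !inE eqxx orbT.
rewrite !inE => /orP[]/eqP ebc /orP[]/eqP eac.
- by move: ab; rewrite (vI _ _ bm cm ebc) (vI _ _ am cm eac) ltnn.
- have bc := vI _ _ bm cm ebc; have ad := vI _ _ am dm eac.
  lia.
- by rewrite (vI _ _ bm dm ebc) (vI _ _ am cm eac).
- by move: ab; rewrite (vI _ _ bm dm ebc) (vI _ _ am dm eac) ltnn.
Qed.

(* f i is the guessed exceptional common neighbour of v (2i) and v (2i+1). *)
Definition sparse_pairs {V : finType} {h : nat} (v : nat -> V)
    (f : {ffun 'I_h -> 'I_h.*2}) (J : {set {set V}}) :=
  [forall i : 'I_h, forall j : 'I_h.*2, (i.*2.+1 < j)%N && (j != f i) ==>
    ~~ (([set v i.*2; v j] \in J) && ([set v i.*2.+1; v j] \in J))].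

(** Pair i has 2h - 2i - 2 later vertices, one of them lost to the guess. The terms are the odd
    numbers 2h - 3, ..., 3, 1, with sum (h-1)^2, and then 0 for i = h - 1 by truncated
    subtraction. *)
Lemma sum_odd_gaps (h : nat) : (h.-1 ^ 2 <= \sum_(i < h) (h.*2 - i.*2.+3))%N.
Proof.
elim: h => [|h IH]; first by rewrite big_ord0.
rewrite big_ord_recl /=.
rewrite (eq_bigr (fun i : 'I_h => h.*2 - i.*2.+3)%N); last first.
  by move=> i _; rewrite /bump /=; lia.
case: h IH => [//|h] /=; move: (\sum_(i < _) _)%N => s IH.
by rewrite -mulnn in IH *; nia.
Qed.

Lemma card_sparse_pairs (h : nat) (f : {ffun 'I_h -> 'I_h.*2}) :
  (h.-1 ^ 2 <= #|[pred t : 'I_h * 'I_h.*2 | (t.1.*2.+1 < t.2) && (t.2 != f t.1)]|)%N.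
Proof.
rewrite -sum1_card /= -(pair_big_dep predT
  (fun (i : 'I_h) (j : 'I_h.*2) => (i.*2.+1 < j)%N && (j != f i)) (fun _ _ => 1%N)) /=.
apply: leq_trans (sum_odd_gaps h) _; apply: leq_sum => i _; rewrite sum1_card.
pose A := [pred j : 'I_h.*2 | (i.*2.+1 < j)%N && (j != f i)].
change (h.*2 - i.*2.+3 <= #|A|)%N.
have cA := cardC A; rewrite card_ord in cA.
rewrite -[X in (X - _ <= _)%N]cA leq_subLR addnC leq_add2r.
have le : (i.*2.+2 <= h.*2)%N by have := ltn_ord i; lia.
(* The excluded j are the 2i + 2 indices up to 2i + 1 and the guess [f i]; these may overlap, so 2i
   + 3 is only an upper bound. *)
have <- : (#|[pred j : 'I_h.*2 | (j < i.*2.+2)%N]| + #|pred1 (f i)| = i.*2.+3)%N.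
  by rewrite card1 -sum1_card (big_ord_narrow le) sum1_card card_ord addn1.
rewrite -cardUI; apply: leq_trans _ (leq_addr _ _).
apply: subset_leq_card; apply/fintype.subsetP => j; rewrite !inE negb_and negbK.
by rewrite -leqNgt.
Qed.

(** The paths v_{2i}, v_j, v_{2i+1} share no edge: the larger index of an edge is j, and the smaller
    one gives i and, by its parity, the side. Hence [prob_no_pair] applies. *)
Lemma prob_sparse_pairs {R : realType} {V : finType} (p : R) (h : nat)
    (v : nat -> V) (f : {ffun 'I_h -> 'I_h.*2}) :
    0 <= p -> p <= 1 ->
    (forall i j, (i < h.*2)%N -> (j < h.*2)%N -> v i = v j -> i = j) ->
  \sum_(J | sparse_pairs v f J) bernoulli_weight p J <= (1 - p ^+ 2) ^+ (h.-1 ^ 2).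
Proof.
move=> p0 p1 vI.
pose P := [pred t : 'I_h * 'I_h.*2 | (t.1.*2.+1 < t.2)%N && (t.2 != f t.1)].
pose a (t : {t | P t}) := [set v (val t).1.*2; v (val t).2].
pose b (t : {t | P t}) := [set v (val t).1.*2.+1; v (val t).2].
have abI : injective (fun t : {t | P t} * bool => if t.2 then a t.1 else b t.1).
  have cE (t : {t | P t} * bool) : (if t.2 then a t.1 else b t.1) =
      [set v ((val t.1).1.*2 + ~~ t.2)%N; v (val t.1).2].
    by case: t => t [] /=; rewrite ?addn0 ?addn1.
  move=> [[[i j] Pij] d] [[[i' j'] Pij'] d']; rewrite !cE /= => E.
  have /andP[/= ij _] := Pij; have /andP[/= ij' _] := Pij'.
  have ijd : (i.*2 + ~~ d < j < h.*2)%N by rewrite ltn_ord andbT; case: (d) => /=; lia.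
  have ijd' : (i'.*2 + ~~ d' < j' < h.*2)%N.
    by rewrite ltn_ord andbT; case: (d') => /=; lia.
  have [ei ej] := set2_nat_inj _ _ _ _ _ _ vI ijd ijd' E.
  have dd : d = d' by case: (d) (d') ei => [] [] /=; lia.
  congr pair => //; apply/val_inj => /=; congr pair; apply/val_inj => //=.
  by move: ei; rewrite dd; lia.
have q0 : 0 <= 1 - p ^+ 2 by nra.
apply: (@le_trans _ _ ((1 - p ^+ 2) ^+ #|{: {t | P t}}|)); last first.
  by rewrite card_sig; apply: ler_wiXn2l => //; [nra|exact: card_sparse_pairs].
rewrite -(prob_no_pair p _ _ abI) big_mkcond [leRHS]big_mkcond.
apply: ler_sum => J _; case: ifPn => [sp|_]; last first.
  by case: ifP => _ //; exact: bernoulli_weight_ge0.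
rewrite ifT //; apply/forallP => -[[i j] Pij].
by have /forallP/(_ i)/forallP/(_ j)/implyP/(_ Pij) := sp.
Qed.

(** Factor by factor: N <= (j + 1)(N - j) whenever j < N. *)
Lemma expn_le_fact (N j : nat) : (j <= N)%N -> (N ^ j <= j`! * N ^_ j)%N.
Proof.
elim: j => [//|j IH] jN; have := IH (ltnW jN); rewrite expnS ffactnSr factS => IHj.
apply: leq_trans (leq_mul (_ : N <= j.+1 * (N - j))%N IHj) _; last by lia.
by rewrite -(subnK jN); move: (N - j.+1)%N => d; nia.
Qed.

Lemma ffact_le_expn (n m : nat) : (n ^_ m <= n ^ m)%N.
Proof.
elim: m => // m IH; rewrite ffactnSr expnSr; exact: leq_mul IH (leq_subr _ _).
Qed.

(** The denominator (2h)! of the binomial coefficient absorbs the guesses: (2h)^h <= h!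
    (2h)(2h-1)...(h+1) = (2h)!. *)
Lemma bin_double_expn_le (n h : nat) : ('C(n, h.*2) * h.*2 ^ h <= n ^ h.*2)%N.
Proof.
apply: leq_trans _ (ffact_le_expn _ _); rewrite -bin_ffact leq_mul2l.
apply/orP; right; have hh : (h <= h.*2)%N by lia.
apply: leq_trans (expn_le_fact _ _ hh) _; rewrite -(ffact_fact hh) mulnC.
by rewrite (_ : h.*2 - h = h)%N //; lia.
Qed.

(** Each set is listed in the fixed order of [enum], so the union bound runs over sets rather than
    sequences of vertices. *)
Definition has_sparse_pairs {V : finType} (x0 : V) (h : nat) (J : {set {set V}}) :=
  [exists Sf : {set V} * {ffun 'I_h -> 'I_h.*2},
    (#|Sf.1| == h.*2) && sparse_pairs (nth x0 (enum Sf.1)) Sf.2 J].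

Lemma nth_enum_inj {V : finType} (x0 : V) (S : {set V}) (i j : nat) :
  (i < #|S|)%N -> (j < #|S|)%N -> nth x0 (enum S) i = nth x0 (enum S) j -> i = j.
Proof. by rewrite cardE => iS jS /eqP; rewrite nth_uniq ?enum_uniq // => /eqP. Qed.

Lemma prob_has_sparse_pairs {R : realType} {V : finType} (x0 : V) (p : R) (h : nat) :
    0 <= p -> p <= 1 ->
  \sum_(J | has_sparse_pairs x0 h J) bernoulli_weight p J
  <= #|V|%:R ^+ h.*2 * (1 - p ^+ 2) ^+ (h.-1 ^ 2).
Proof.
move=> p0 p1.
apply: le_trans (@union_bound R {set {set V}} _ (bernoulli_weight p)
  (fun Sf : {set V} * {ffun 'I_h -> 'I_h.*2} => #|Sf.1| == h.*2)
  (fun Sf J => sparse_pairs (nth x0 (enum Sf.1)) Sf.2 J)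
  ((1 - p ^+ 2) ^+ (h.-1 ^ 2)) _ _) _.
- by move=> J; exact: bernoulli_weight_ge0.
- move=> Sf /eqP cS; apply: prob_sparse_pairs => // i j iS jS.
  by apply: nth_enum_inj; rewrite cS.
rewrite -natrX ler_wpM2r ?exprn_ge0 ?ler_nat //; first by nra.
apply: leq_trans _ (bin_double_expn_le _ _); rewrite -card_draws.
rewrite -[in leqRHS](card_ord h.*2) -[X in (_ ^ X)%N](card_ord h) -card_ffun.
rewrite -(@cardsT {ffun 'I_h -> 'I_h.*2}) -cardsX.
apply/subset_leq_card/fintype.subsetP => -[S f].
by rewrite !inE card_ord andbT; exact: id.
Qed.

(** Guess for each pair its common neighbour among the later vertices; by uniqueness there is no
    other. *)
Lemma unique_common_neighbour_has_sparse_pairs {V : finType} (x0 : V) (h : nat)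
    (J : {set {set V}}) (S : {set V}) :
    (0 < h)%N -> unique_common_neighbour (set_graph J) S -> (h.*2 <= #|S|)%N ->
  has_sparse_pairs x0 h J.
Proof.
move=> h0 ucn /card_geqP[s [us sz sS]].
pose T := [set x in s].
have cT : #|T| = h.*2 by rewrite cardsE -sz; apply/card_uniqP.
have TS x : x \in T -> x \in S by rewrite inE; exact: sS.
pose v := nth x0 (enum T).
have vT i : (i < h.*2)%N -> v i \in T.
  by move=> iT; rewrite -mem_enum mem_nth // -cardE cT.
have vI i j : (i < h.*2)%N -> (j < h.*2)%N -> v i = v j -> i = j.
  by move=> iT jT; apply: nth_enum_inj; rewrite cT.
have h20 : (0 < h.*2)%N by rewrite double_gt0.
pose d : 'I_h.*2 := Ordinal h20.
pose common (i : 'I_h) := [pred j : 'I_h.*2 | [&& (i.*2.+1 < j)%N,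
  [set v i.*2; v j] \in J & [set v i.*2.+1; v j] \in J]].
(* A pair without a later common neighbour gets the default index 0, which does no harm. *)
apply/existsP; exists (T, [ffun i => odflt d [pick j in common i]]) => /=.
rewrite cT eqxx; apply/forallP => i; apply/forallP => j; apply/implyP.
rewrite ffunE => /andP[ij jf]; apply: contra jf => /andP[ja jb].
have adjv (a b : nat) : (a < b < h.*2)%N -> [set v a; v b] \in J ->
    set_graph J (v a) (v b).
  move=> /andP[ab bm] abJ; rewrite /= /set_rel abJ andbT.
  by apply/eqP => /(vI _ _ (ltn_trans ab bm) bm) E; rewrite E ltnn in ab.
have jm := ltn_ord j.
case: pickP => [j'|/(_ j)]; last by rewrite !inE ij ja jb.
rewrite !inE => /and3P[ij' ja' jb'] /=; have jm' := ltn_ord j'.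
have i0m : (i.*2 < h.*2)%N by have := ltn_ord i; lia.
have i1m : (i.*2.+1 < h.*2)%N by have := ltn_ord i; lia.
apply/eqP/val_inj/vI => //=.
apply: (ucn (v i.*2) (v i.*2.+1)); rewrite ?TS ?vT //.
- by apply/eqP => /(vI _ _ i0m i1m); lia.
- by apply: adjv => //; rewrite jm andbT; lia.
- by apply: adjv => //; rewrite jm andbT; lia.
- by apply: adjv => //; rewrite jm' andbT; lia.
- by apply: adjv => //; rewrite jm' andbT; lia.
Qed.

(** * Size of dense induced subgraphs *)

Lemma avg_degree_induced_card {R : realType} {V : finType} (G : sgraph V)
    (S : {set V}) (k : nat) :
    (0 < k)%N -> unique_common_neighbour G S ->
    k%:R <= avg_degree R (induced_subgraph G S) ->
  (k ^ 2 - k < #|S|)%N.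
Proof.
move=> k0 ucn kd.
have cS : #|{: {x : V | x \in S}}| = #|S| by rewrite card_sig; apply: eq_card.
(* An empty [S] would give average degree 0, below k because k > 0. *)
have S0 : (0 < #|S|)%N.
  rewrite lt0n; apply: contraTneq kd => S0.
  by rewrite /avg_degree cS S0 invr0 mulr0 -ltNge ltr0n.
have := unique_common_neighbour_card (induced_subgraph G S) k; rewrite cS.
apply=> //.
  move=> x y z w _ _ _ _ xy xz yz xw yw; apply/val_inj.
  exact: (ucn (val x) (val y) (val z) (val w) (valP x) (valP y) (valP z) (valP w)).
move: kd; rewrite /avg_degree cS ler_pdivlMr ?ltr0n // -natrM ler_nat.
by [].
Qed.

(** * Numerical estimates and the choice of the graph *)

Lemma bin2_double (n : nat) : ('C(n, 2).*2 = n * n.-1)%N.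
Proof. by rewrite -muln2 -[2%N in LHS]/(2`!) bin_ffact ffactnS ffactn1. Qed.

(** If the three events covered everything, each weight would occur at least once in the three
    sums. *)
Lemma exists_outside3 {R : realType} {W : finType} (w : W -> R) (A B C : pred W) :
    (forall J, 0 <= w J) ->
    \sum_(J | A J) w J + \sum_(J | B J) w J + \sum_(J | C J) w J < \sum_J w J ->
  exists J, [/\ ~~ A J, ~~ B J & ~~ C J].
Proof.
move=> w0 lt; have [/existsP[J /and3P[]]|bad] :=
  boolP [exists J, [&& ~~ A J, ~~ B J & ~~ C J]].
  by exists J.
exfalso; move: lt; rewrite ltNge => /negP; apply.
rewrite (big_mkcond A) (big_mkcond B) (big_mkcond C) -!big_split /=.
apply: ler_sum => J _; move: bad => /existsPn/(_ J).
by have := w0 J; case: (A J) (B J) (C J) => [] [] [] //= ?; lra.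
Qed.

(** For k = 2 and k = 3 the exponent is -1 and -1/2, so the power, and with it the product, is at
    least 1. *)
Lemma four_le_of_powR_lt {R : realType} (k n : nat) (q : R) :
    (2 <= k)%N -> (0 < n)%N -> 0 < q <= 1 ->
    n%:R * q `^ ((k%:R ^+ 2 - 3 * k%:R - 2) / 4) <= 1 / 2 ->
  (4 <= k)%N.
Proof.
move=> k2 n0 q01; apply: contraTT; rewrite -ltnNge -ltNge => k4.
have n1 : 1 <= n%:R :> R by rewrite ler1n.
have q1 : 1 <= q `^ ((k%:R ^+ 2 - 3 * k%:R - 2) / 4).
  rewrite -[leLHS](powRr0 q); apply: ger_powR => //.
  have k23 : k = 2%N \/ k = 3%N by lia.
  by case: k23 => ->; lra.
by nra.
Qed.

(** From 2h = k^2 - k follows 2h (k^2 - 3k - 2)/4 = h (h - k - 1) <= (h - 1)^2; also 1 - p^2 <= 1 -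
    p^4. So the quantity is at most the 2h-th power of the one assumed to be <= 1/2, and 2h >= 6. *)
Lemma powR_binomial_bound {R : realType} (k n h : nat) (p : R) :
    (4 <= k)%N -> (h.*2 = k * k.-1)%N -> 0 <= p -> p <= 1 ->
    n%:R * (1 - p ^+ 4) `^ ((k%:R ^+ 2 - 3 * k%:R - 2) / 4) <= 1 / 2 ->
  n%:R ^+ h.*2 * (1 - p ^+ 2) ^+ (h.-1 ^ 2) <= 1 / 64.
Proof.
move=> k4 hk p0 p1 hn.
have q0 : 0 <= 1 - p ^+ 4 by rewrite subr_ge0 exprn_ile1.
have r0 : 0 <= 1 - p ^+ 2 by rewrite subr_ge0 exprn_ile1.
have r1 : 1 - p ^+ 2 <= 1 by rewrite gerBl exprn_ge0.
have rq : 1 - p ^+ 2 <= 1 - p ^+ 4 by rewrite lerB // ler_wiXn2l.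
(* This makes the truncated difference h - (k + 1) a true one. *)
have hk1 : (k.+1 <= h)%N by nia.
have h6 : (6 <= h)%N by nia.
apply: (@le_trans _ _ (n%:R ^+ h.*2 * (1 - p ^+ 4) ^+ (h * (h - k.+1)))).
  rewrite ler_wpM2l ?exprn_ge0 //.
  apply: (@le_trans _ _ ((1 - p ^+ 2) ^+ (h * (h - k.+1)))).
    by apply: ler_wiXn2l => //; nia.
  by rewrite lerXn2r ?nnegrE.
have <- : ((1 - p ^+ 4) `^ ((k%:R ^+ 2 - 3 * k%:R - 2) / 4)) ^+ h.*2 =
    (1 - p ^+ 4) ^+ (h * (h - k.+1)).
  rewrite -[LHS]powR_mulrn ?powR_ge0 // -powRrM -[RHS]powR_mulrn //; congr (_ `^ _).
  have hkR : 2 * h%:R = k%:R ^+ 2 - k%:R :> R.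
    rewrite -natrX -natrB ?leq_pexp2l -?natrM //; last by nia.
    by congr _%:R; rewrite mul2n hk; nia.
  rewrite natrM natrB // -mul2n natrM -addn1 natrD hkR.
  by rewrite (_ : h%:R = (k%:R ^+ 2 - k%:R) / 2); [field | lra].
rewrite -exprMn; apply: (@le_trans _ _ ((1 / 2) ^+ h.*2)).
  by rewrite lerXn2r ?nnegrE ?mulr_ge0 ?powR_ge0 //; lra.
apply: (@le_trans _ _ ((1 / 2) ^+ 6)); last by lra.
by apply: ler_wiXn2l; [lra|lra|lia].
Qed.

Theorem theorem6p4 (R : realType) (k s n : nat) (p : R)
    (hk : (2 <= k)%N) (hs : (2 <= s)%N) (hn : (0 < n)%N)
    (hp0 : 0 <= p) (hp1 : p <= 1)
    (hmax :
      Num.max (n%:R ^+ 2 * p ^+ s)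
        (Num.max
          (n%:R * (1 - p ^+ 4) `^ ((k%:R ^+ 2 - 3 * k%:R - 2) / 4))
          (expR (- ('C(n, 2)%:R * p / 4)))) <= 1 / 2) :
  exists G : sgraph 'I_n,
    [/\ (n%:R - 1) / 2 * p <= avg_degree R G,
        graph_free (complete_bipartite s s) G
      & forall S : {set 'I_n},
          graph_free (cycle_graph 4) (induced_subgraph G S) ->
          avg_degree R (induced_subgraph G S) < k%:R].
Proof.
move: hmax; rewrite !ge_max => /and3P[hB hC hA].
have n1 : 1 <= n%:R :> R by rewrite ler1n.
(* The base 1 - p^4 has to be positive when the exponent is negative, since [powR] sends 0 to 0
   there. *)
have p_lt1 : p < 1.
  rewrite lt_neqAle hp1 andbT; apply: contraTneq hB => ->.
  by rewrite expr1n mulr1 -ltNge; nra.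
have q01 : 0 < 1 - p ^+ 4 <= 1.
  by rewrite subr_gt0 exprn_ilt1 //= gerBl exprn_ge0.
have k4 := four_le_of_powR_lt _ _ _ hk hn q01 hC.
pose h := 'C(k, 2); have hh : (h.*2 = k * k.-1)%N := bin2_double k.
have h0 : (0 < h)%N by rewrite bin_gt0.
pose D := [set e : {set 'I_n} | #|e| == 2]; pose x0 : 'I_n := Ordinal hn.
have cD : #|D| = 'C(n, 2) by rewrite card_draws card_ord.
(* 71/100 is a rational just above 2^(-1/2), and 71/100 + 1/4 + 1/64 is still below 1. *)
have PA : expR (- ('C(n, 2)%:R * p / 8)) <= 71 / 100 :> R.
  have y0 := expR_ge0 (- ('C(n, 2)%:R * p / 8)).
  have : expR (- ('C(n, 2)%:R * p / 8)) ^+ 2 <= 1 / 2 :> R.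
    by rewrite -expRM_natr (_ : _ * 2 = - ('C(n, 2)%:R * p / 4)) //; field.
  by nra.
have PB : n%:R ^+ (s + s) * p ^+ (s * s) <= 1 / 4.
  rewrite addnn -mul2n !exprM -exprMn.
  apply: (@le_trans _ _ ((1 / 2) ^+ s)).
    by rewrite lerXn2r ?nnegrE ?mulr_ge0 ?exprn_ge0 //; lra.
  by apply: (@le_trans _ _ ((1 / 2) ^+ 2)); [apply: ler_wiXn2l => //; lra|lra].
have PC := powR_binomial_bound _ _ _ _ k4 hh hp0 hp1 hC.
have [J [JA JB JC]] : exists J : {set {set 'I_n}},
    [/\ ~~ (#|J :&: D|%:R < #|D|%:R * p / 2),
        ~~ [exists f : {ffun 'I_s + 'I_s -> 'I_n},
              injectiveb f && (biclique_edges f \subset J)]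
      & ~~ has_sparse_pairs x0 h J].
  apply: (exists_outside3 (bernoulli_weight p)) => [J|].
    exact: bernoulli_weight_ge0.
  rewrite sum_bernoulli_weight.
  have := prob_lower_tail p D hp0 hp1; rewrite cD => bA.
  have bB := prob_biclique (V := 'I_n) p s s hp0 hp1.
  have bC := prob_has_sparse_pairs x0 p h hp0 hp1.
  rewrite card_ord in bB bC.
  apply: le_lt_trans (lerD (lerD (le_trans bA PA) (le_trans bB PB)) (le_trans bC PC)) _.
  by clear; lra.
exists (set_graph J); split.
- move: JA; rewrite -leNgt cD card_edges_set_graph /avg_degree card_ord => JA.
  rewrite ler_pdivlMr ?ltr0n // natrM.
  (* By this identity, C(n,2) p/2 edges mean average degree (n - 1) p/2. *)
  have : 2 * 'C(n, 2)%:R = n%:R * (n%:R - 1) :> R.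
    by rewrite -natrM mul2n bin2_double natrM -subn1 natrB.
  by nra.
- by move=> /has_biclique_edges; apply/negP.
move=> S /c4_free_unique_common_neighbour ucn; rewrite ltNge; apply: contra JC => kS.
have := avg_degree_induced_card _ _ _ (ltnW hk) ucn kS => cS.
apply: (unique_common_neighbour_has_sparse_pairs _ _ _ _ h0 ucn).
by rewrite hh -subn1 mulnBr muln1 mulnn ltnW.
Qed.
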